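(* For all $n \ge 0$, $$\sum_{\sigma \in \mathrm{Av}_n(\bar1\bar243)} q^{\mathrm{des}(\sigma)} = \sum_{\sigma \in \mathrm{Av}_n(\bar132\bar4)} q^{\mathrm{des}(\sigma)} = \begin{cases} 1 & \text{if } n = 0,1,\\ A_{n-2}(q) & \text{if } n \ge 2,\end{cases}$$ where $A_m(q) = \sum_{\sigma\in\mathfrak{S}_m} q^{\mathrm{des}(\sigma)}$ is the Eulerian polynomial.
   Context: $\mathfrak{S}_n$ is the set of permutations of $[n]=\{1,\dots,n\}$, written in one-line notation $\sigma = a_1\dots a_n$ with $a_i=\sigma(i)$; $\mathfrak{S}_0$ consists of the empty permutation, which has no descents, so $A_0(q)=1$. The descent statistic is $\mathrm{des}(\sigma) = |\{i \in [n-1] : a_i > a_{i+1}\}|$. A subsequence of $\sigma$ is an occurrence of a pattern $\pi$ if its letters are in the same relative order as those of $\pi$; in particular $a_ia_j$ is an occurrence of $21$ if $i<j$ and $a_i>a_j$. Avoidance of the two barred patterns is defined as follows. A permutation $\sigma=a_1\dots a_n$ avoids $\bar1\bar243$ if, whenever $a_ia_j$ is an occurrence of $21$, there are integers $k<l<i$ such that $a_ka_la_ia_j$ is an occurrence of $1243$. A permutation $\sigma$ avoids $\bar132\bar4$ if, whenever $a_ia_j$ is an occurrence of $21$, there are integers $k,l$ with $k<i<j<l$ such that $a_ka_ia_ja_l$ is an occurrence of $1324$. $\mathrm{Av}_n(p)$ denotes the set of permutations in $\mathfrak{S}_n$ avoiding the barred pattern $p$. *)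

(* Defs.v *)
From mathcomp Require Import all_boot all_order all_algebra all_fingroup.

Set Implicit Arguments.
Unset Strict Implicit.
Unset Printing Implicit Defensive.

Import GRing.Theory.

Local Open Scope ring_scope.

(* A permutation a_1 ... a_n of [n] is [s : 'S_n], with positions and values
   both shifted down by one: a_i = (s (i - 1)) + 1. *)

Definition des (n : nat) (s : 'S_n) : nat :=
  #|[set i : 'I_n | [exists j : 'I_n, (j == i.+1 :> nat) && (s j < s i)%N]]|.

Definition same_relative_order (u v : seq nat) : bool :=
  (size u == size v) &&
  [forall a : 'I_(size u), forall b : 'I_(size u),
     (nth 0%N u a < nth 0%N u b)%N == (nth 0%N v a < nth 0%N v b)%N].

(* The letters of [s] at the positions [t] (which must be increasing) form an
   occurrence of the pattern [p], given in one-line notation. *)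
Definition occurrence (n : nat) (p : seq nat) (s : 'S_n) (t : seq 'I_n) : bool :=
  sorted ltn [seq val i | i <- t] &&
  same_relative_order p [seq val (s i) | i <- t].

(* Avoidance of the barred pattern 1243 with bars on 1 and 2. *)
Definition avoids_b1b243 (n : nat) (s : 'S_n) : bool :=
  [forall i : 'I_n, forall j : 'I_n,
     occurrence [:: 2; 1]%N s [:: i; j] ==>
     [exists k : 'I_n, exists l : 'I_n,
        occurrence [:: 1; 2; 4; 3]%N s [:: k; l; i; j]]].

(* Avoidance of the barred pattern 1324 with bars on 1 and 4. *)
Definition avoids_b132b4 (n : nat) (s : 'S_n) : bool :=
  [forall i : 'I_n, forall j : 'I_n,
     occurrence [:: 2; 1]%N s [:: i; j] ==>
     [exists k : 'I_n, exists l : 'I_n,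
        occurrence [:: 1; 3; 2; 4]%N s [:: k; i; j; l]]].

Definition Av_b1b243 (n : nat) : {set 'S_n} := [set s | avoids_b1b243 s].

Definition Av_b132b4 (n : nat) : {set 'S_n} := [set s | avoids_b132b4 s].

Definition eulerian (m : nat) : {poly int} := \sum_(s : 'S_m) 'X^(des s).

(* Main.v *)
(* The first letter 1 and the last letter n of a permutation admit no smaller
   letter before and no larger letter after them, so every inversion extends to
   1324 in the required way exactly when sigma(1) = 1 and sigma(n) = n.
   Likewise every inversion extends to 1243 in the required way exactly when
   sigma starts with 12.  In both cases deleting the two forced letters is a
   bijection onto S_(n-2), and it preserves descents because an initial minimum
   or a final maximum never takes part in one. *)

Require Import Defs.
From mathcomp Require Import all_boot all_order all_algebra all_fingroup.
From mathcomp Require Import zify.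

Set Implicit Arguments.
Unset Strict Implicit.
Unset Printing Implicit Defensive.

Import GRing.Theory.

Local Open Scope ring_scope.

(** Trades quantifiers over ordinals for [all] over [iota], which computes on concrete patterns and
    leaves plain inequalities for [lia]. *)
Lemma forall_ordE (n : nat) (P : pred nat) :
  [forall a : 'I_n, P a] = all P (iota 0 n).
Proof.
apply/forallP/allP => [Pord a | Piota a].
  by rewrite mem_iota => lt_an; apply: (Pord (Ordinal lt_an)).
by apply: Piota; rewrite mem_iota /= add0n ltn_ord.
Qed.

Lemma same_relative_orderE (u v : seq nat) :
  same_relative_order u v =
  (size u == size v) &&
  all (fun a => all (fun b => (nth 0%N u a < nth 0%N u b)%N ==
                              (nth 0%N v a < nth 0%N v b)%N)
                    (iota 0 (size u))) (iota 0 (size u)).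
Proof.
rewrite /same_relative_order -forall_ordE; congr (_ && _).
by apply: eq_forallb => a; rewrite -forall_ordE.
Qed.

Lemma occurrence21E (n : nat) (s : 'S_n) (i j : 'I_n) :
  occurrence [:: 2; 1]%N s [:: i; j] = (i < j)%N && (s j < s i)%N.
Proof. by rewrite /occurrence same_relative_orderE /=; lia. Qed.

Lemma occurrence1243E (n : nat) (s : 'S_n) (k l i j : 'I_n) :
  occurrence [:: 1; 2; 4; 3]%N s [:: k; l; i; j] =
  [&& k < l, l < i, i < j, s k < s l, s l < s j & s j < s i]%N.
Proof. by rewrite /occurrence same_relative_orderE /=; lia. Qed.

Lemma occurrence1324E (n : nat) (s : 'S_n) (k i j l : 'I_n) :
  occurrence [:: 1; 3; 2; 4]%N s [:: k; i; j; l] =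
  [&& k < i, i < j, j < l, s k < s j, s j < s i & s i < s l]%N.
Proof. by rewrite /occurrence same_relative_orderE /=; lia. Qed.

Lemma avoids_b132b4E (n : nat) (s : 'S_n.+2) :
  avoids_b132b4 s = (s ord0 == ord0) && (s ord_max == ord_max).
Proof.
apply/idP/andP => [/forallP avs | [/eqP s0 /eqP smax]].
  have {}avs (i j : 'I_n.+2) : (i < j)%N -> (s j < s i)%N ->
      exists k l : 'I_n.+2, [/\ k < i, j < l, s k < s j & s i < s l]%N.
    move=> ltij ltsji; have /forallP/(_ j)/implyP := avs i.
    rewrite occurrence21E ltij ltsji => /(_ isT)/existsP[k]/existsP[l].
    by rewrite occurrence1324E => /and5P[? ? ? ? /andP[? ?]]; exists k, l.
  split; apply: contraT => nfix.
    (* If the value 0 is not first, positions 0 and [s^-1 ord0] form an inversion, and no position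
       [k] precedes 0. *)
    have sV0 : (s^-1 ord0)%g != ord0.
      by rewrite -(inj_eq (@perm_inj _ s)) permKV eq_sym.
    have := avs ord0 (s^-1 ord0)%g; rewrite permKV !lt0n.
    by move=> /(_ sV0 nfix)[k [l []]].
  have lt_max (i : 'I_n.+2) : i != ord_max -> (i < n.+1)%N.
    by move: (ltn_ord i); rewrite -val_eqE /=; lia.
  (* Dually, the maximal value and the last letter form an inversion, and no position [l] follows
     the last one. *)
  have sVm : (s^-1 ord_max)%g != ord_max.
    by rewrite -(inj_eq (@perm_inj _ s)) permKV eq_sym.
  have := avs (s^-1 ord_max)%g ord_max; rewrite permKV.
  move=> /(_ (lt_max _ sVm) (lt_max _ nfix))[k [l [_]]].
  by rewrite ltnNge -ltnS ltn_ord.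
apply/forallP => i; apply/forallP => j; apply/implyP.
rewrite occurrence21E => /andP[ltij ltsji].
apply/existsP; exists ord0; apply/existsP; exists ord_max.
rewrite occurrence1324E s0 smax ltij ltsji /=.
(* The fixed extreme points take part in no inversion, which makes all inequalities with the
   witnesses [ord0] and [ord_max] strict. *)
have i0 : i != ord0 by apply: contraTN ltsji => /eqP ->; rewrite s0.
have jm : j != ord_max.
  by apply: contraTN ltsji => /eqP ->; rewrite smax -leqNgt -ltnS ltn_ord.
have sj0 : s j != ord0.
  by rewrite -s0 (inj_eq perm_inj); apply: contraTN ltij => /eqP ->.
have sim : s i != ord_max.
  rewrite -smax (inj_eq perm_inj); apply: contraTN ltij => /eqP ->.
  by rewrite -leqNgt -ltnS ltn_ord.
move: (ltn_ord j) (ltn_ord (s i)) i0 jm sj0 sim; rewrite -!val_eqE /=; lia.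
Qed.

Lemma avoids_b1b243E (n : nat) (s : 'S_n.+2) :
  avoids_b1b243 s =
  (s ord0 == ord0) && (s (lift ord0 ord0) == lift ord0 ord0).
Proof.
apply/idP/andP => [/forallP avs | [/eqP s0 /eqP s1]].
  (* Two positions [k < l] lie before [i] and two values [s k < s l] lie below [s j]; only these
     bounds are needed. *)
  have {}avs (i j : 'I_n.+2) :
      (i < j)%N -> (s j < s i)%N -> (1 < i)%N && (1 < s j)%N.
    move=> ltij ltsji; have /forallP/(_ j)/implyP := avs i.
    rewrite occurrence21E ltij ltsji => /(_ isT)/existsP[k]/existsP[l].
    by rewrite occurrence1243E => /and5P[? ? ? ? /andP[? ?]]; lia.
  have s0 : s ord0 = ord0.
    apply/eqP; apply: contraT => ns0.
    have sV0 : (s^-1 ord0)%g != ord0.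
      by rewrite -(inj_eq (@perm_inj _ s)) permKV eq_sym.
    have := avs ord0 (s^-1 ord0)%g; rewrite permKV !lt0n.
    by move=> /(_ sV0 ns0).
  split; first by rewrite s0.
  apply: contraT => ns1; set o1 := lift ord0 ord0 in ns1.
  have s1gt0 : s o1 != ord0 by rewrite -{1}s0 (inj_eq perm_inj).
  have sV1 : (s^-1 o1)%g != ord0 by rewrite -(inj_eq (@perm_inj _ s)) permKV s0.
  have sV1' : (s^-1 o1)%g != o1.
    by rewrite -(inj_eq (@perm_inj _ s)) permKV eq_sym.
  (* With 0 fixed and 1 moved, positions 1 and [s^-1 o1] form an inversion that starts too early, at
     position 1. *)
  have := avs o1 (s^-1 o1)%g; rewrite permKV.
  move: s1gt0 ns1 sV1 sV1'; rewrite -!val_eqE /= /bump /=; lia.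
apply/forallP => i; apply/forallP => j; apply/implyP.
rewrite occurrence21E => /andP[ltij ltsji].
apply/existsP; exists ord0; apply/existsP; exists (lift ord0 ord0).
rewrite occurrence1243E s0 s1 ltij ltsji /= /bump /= andbT.
have sj0 : s j != ord0.
  by rewrite -s0 (inj_eq perm_inj); apply: contraTN ltij => /eqP ->.
have i0 : i != ord0 by apply: contraTN ltsji => /eqP ->; rewrite s0.
have i1 : i != lift ord0 ord0.
  apply: contraTN ltsji => /eqP ->; rewrite s1 -leqNgt.
  by rewrite lt0n; apply: contra sj0 => /eqP ?; apply/eqP/val_inj.
have sj1 : s j != lift ord0 ord0.
  rewrite -s1 (inj_eq perm_inj); apply: contraTN ltij => /eqP ->.
  by rewrite -leqNgt lt0n; apply: contra i0 => /eqP ?; apply/eqP/val_inj.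
move: i0 i1 sj0 sj1; rewrite -!val_eqE /= /bump /=; lia.
Qed.

(** The descent set of the lifted permutation is the image of that of [s] under [lift h]. As [h] is
    an end, [lift h] is a shift by one or leaves values unchanged, so it preserves adjacency. *)
Lemma des_lift_perm (n : nat) (h : 'I_n.+1) (s : 'S_n) :
  h = ord0 \/ h = ord_max -> des (lift_perm h h s) = des s.
Proof.
move=> h_end; rewrite /des -[RHS](card_imset _ (@lift_inj _ h)).
apply: eq_card => i; case: (unliftP h i) => [i'|] ->.
  rewrite mem_imset ?inE; last exact: lift_inj.
  rewrite lift_perm_lift.
  apply/existsP/existsP => -[j /andP[/eqP ji lts]].
    move: ji lts; case: (unliftP h j) => [j'|] ->.
      rewrite lift_perm_lift => ji lts; exists j'; apply/andP; split.
        by case: h_end ji => ->; rewrite ?lift0 ?lift_max; lia.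
      by move: lts; rewrite /= ltnNge leq_bump2 -ltnNge.
    (* The successor cannot be [h]: position 0 succeeds nothing, and the maximal value is below
       nothing. *)
    rewrite lift_perm_id; case: h_end => -> // _.
    by rewrite ltnNge -ltnS ltn_ord.
  exists (lift h j); rewrite lift_perm_lift; apply/andP; split.
    by case: h_end => ->; rewrite ?lift0 ?lift_max ji.
  by rewrite /= ltnNge leq_bump2 -ltnNge.
(* Nor is [h] itself a descent: the value 0 exceeds nothing, and the last position has no
   successor. *)
rewrite inE; apply/existsP/imsetP => [[j]|[i' _ /eqP]];
  last by rewrite eq_liftF.
rewrite lift_perm_id => /andP[/eqP ji lts].
case: h_end ji lts => -> //= ji _.
by move: (ltn_ord j); rewrite ji ltnn.
Qed.

Lemma lift_perm_inj (n : nat) (i j : 'I_n.+1) : injective (lift_perm i j).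
Proof.
move=> s t eq_st; apply/permP => k; apply: (@lift_inj _ j).
by rewrite -!(lift_perm_lift i) eq_st.
Qed.

Lemma lift_perm_surj (n : nat) (i j : 'I_n.+1) (s : 'S_n.+1) :
  s i = j -> exists t : 'S_n, s = lift_perm i j t.
Proof.
move=> sij.
(* The default [k] is never reached, since [s] takes the value [j] only at [i]. *)
pose f k := odflt k (unlift j (s (lift i k))).
have fE k : lift j (f k) = s (lift i k).
  rewrite /f; have := neq_lift i k.
  by rewrite -(inj_eq (@perm_inj _ s)) sij => /unlift_some[k' -> ->].
have f_inj : injective f.
  by move=> k l /(congr1 (lift j)); rewrite !fE => /perm_inj/lift_inj.
exists (perm f_inj); apply/permP => k; case: (unliftP i k) => [k'|] ->.
  by rewrite lift_perm_lift permE fE.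
by rewrite lift_perm_id.
Qed.

(** Deletes one fixed end. The predicate [P] carries the other condition along, so that two
    applications delete both forced letters. *)
Lemma sum_des_fixed_end (n : nat) (h : 'I_n.+1) (P : pred 'S_n.+1) :
  h = ord0 \/ h = ord_max ->
  \sum_(s : 'S_n.+1 | (s h == h) && P s) 'X^(des s) =
  \sum_(t | P (lift_perm h h t)) 'X^(des t) :> {poly int}.
Proof.
move=> h_end.
transitivity (\sum_(s in lift_perm h h @: [set t | P (lift_perm h h t)])
                'X^(des s) : {poly int}).
  apply: eq_bigl => s; apply/andP/imsetP => [[/eqP sh Ps]|[t]].
    by have [t s_t] := lift_perm_surj sh; exists t; rewrite // inE -s_t.
  by rewrite inE => Pt ->; rewrite lift_perm_id eqxx.
rewrite big_imset /=; last by apply: in2W; apply: lift_perm_inj.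
by apply: eq_big => t; rewrite ?inE ?des_lift_perm.
Qed.

Lemma sum_Av_b132b4 (m : nat) :
  \sum_(s in Av_b132b4 m.+2) 'X^(des s) = eulerian m :> {poly int}.
Proof.
under eq_bigl do rewrite inE avoids_b132b4E.
rewrite sum_des_fixed_end; last by left.
have liftmax : lift ord0 ord_max = ord_max :> 'I_m.+2 by apply: val_inj.
rewrite (eq_bigl (fun t : 'S_m.+1 =>
                    (t ord_max == ord_max) && predT t)) => [|t].
  by rewrite sum_des_fixed_end //; right.
by rewrite -liftmax lift_perm_lift (inj_eq lift_inj) andbT.
Qed.

Lemma sum_Av_b1b243 (m : nat) :
  \sum_(s in Av_b1b243 m.+2) 'X^(des s) = eulerian m :> {poly int}.
Proof.
under eq_bigl do rewrite inE avoids_b1b243E.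
rewrite sum_des_fixed_end; last by left.
(* Once the first letter is deleted, fixing the point 1 becomes fixing the point 0. *)
rewrite (eq_bigl (fun t : 'S_m.+1 => (t ord0 == ord0) && predT t)) => [|t].
  by rewrite sum_des_fixed_end //; left.
by rewrite lift_perm_lift (inj_eq lift_inj) andbT.
Qed.

(** The identity is the only permutation here, and it has no descent. *)
Lemma sum_des_small (n : nat) (A : {set 'S_n}) :
  (n < 2)%N -> 1%g \in A -> \sum_(s in A) 'X^(des s) = 1 :> {poly int}.
Proof.
move=> lt_n2 A1.
have ord_eq (i j : 'I_n) : i = j
  by apply: val_inj; move: (ltn_ord i) (ltn_ord j) => /=; lia.
have s1 (s : 'S_n) : s = 1%g by apply/permP => i; apply: ord_eq.
rewrite (big_pred1 1%g) => [|s]; last by rewrite /= (s1 s) A1 eqxx.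
rewrite /des (_ : [set _ | _] = set0) ?cards0 //; apply/setP => i.
by rewrite !inE; apply/existsP => -[j]; rewrite (ord_eq j i) ltnn andbF.
Qed.

Theorem proposition3p7 (n : nat) :
  \sum_(s in Av_b1b243 n) 'X^(des s) = \sum_(s in Av_b132b4 n) 'X^(des s)
    :> {poly int} /\
  \sum_(s in Av_b132b4 n) 'X^(des s) =
    (if (n < 2)%N then 1 else eulerian (n - 2)) :> {poly int}.
Proof.
case: (ltnP n 2) => [lt_n2|].
  (* With fewer than two positions there is no inversion, so both avoidance conditions hold
     vacuously. *)
  have no21 (s : 'S_n) i j : occurrence [:: 2; 1]%N s [:: i; j] = false.
    by rewrite occurrence21E; move: (ltn_ord i) (ltn_ord j); lia.
  have Av1 : 1%g \in Av_b1b243 n.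
    by rewrite inE; apply/forallP => i; apply/forallP => j; rewrite no21.
  have Av2 : 1%g \in Av_b132b4 n.
    by rewrite inE; apply/forallP => i; apply/forallP => j; rewrite no21.
  have sum1 := sum_des_small lt_n2 Av1.
  have sum2 := sum_des_small lt_n2 Av2.
  split; last exact: sum2.
  exact: etrans sum1 (esym sum2).
case: n => [|[|m]] le_2n; [by [] | by [] |].
have -> : (m.+2 - 2 = m)%N by rewrite !subSS subn0.
have sum1 := sum_Av_b1b243 m; have sum2 := sum_Av_b132b4 m.
split; last exact: sum2.
exact: etrans sum1 (esym sum2).
Qed.
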